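(* Let $\sigma_0$ be a circular arc in the plane of radius $1$ and of arc length less than $1.32$, and let $\sigma_1$ be obtained from $\sigma_0$ by rotating it about one of its endpoints (by any angle). Then for every $\varepsilon>0$ there is a continuous motion $(g_t)_{t\in[0,1]}$ with $g_0=\mathrm{id}$ and $g_1(\sigma_0)=\sigma_1$ such that the Lebesgue measure of $\bigcup_{t\in[0,1]} g_t(\sigma_0)$ is less than $\varepsilon$.
   Context: A continuous motion is a continuous map $t\mapsto g_t$ from $[0,1]$ into the group of orientation-preserving isometries of $\mathbb{R}^2$ (with its natural topology). *)

(* Defs.v *)
From Stdlib Require Import Reals Lra.
Open Scope R_scope.

Definition pt := (R * R)%type.

Definition cont01 (f : R -> R) : Prop :=
  forall t, 0 <= t <= 1 -> forall eps, 0 < eps ->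
    exists delta, 0 < delta /\
      forall u, 0 <= u <= 1 -> Rabs (u - t) < delta -> Rabs (f u - f t) < eps.

(* An orientation-preserving isometry of R^2 is p |-> Q p + v with Q in SO(2),
   Q = [[c,-s],[s,c]], c^2+s^2 = 1.  The group carries the topology of the
   subspace {(c,s,a,b) | c^2+s^2=1} of R^4. *)
Definition iso_apply (c s a b : R) (p : pt) : pt :=
  (c * fst p - s * snd p + a, s * fst p + c * snd p + b).

Record motion := {
  m_c : R -> R; m_s : R -> R; m_a : R -> R; m_b : R -> R;
  m_SO2 : forall t, 0 <= t <= 1 -> m_c t ^ 2 + m_s t ^ 2 = 1;
  m_cont : cont01 m_c /\ cont01 m_s /\ cont01 m_a /\ cont01 m_b }.

Definition gmap (g : motion) (t : R) (p : pt) : pt :=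
  iso_apply (m_c g t) (m_s g t) (m_a g t) (m_b g t) p.

Definition arc (x0 y0 alpha L : R) (q : pt) : Prop :=
  exists phi, alpha <= phi <= alpha + L /\
    q = (x0 + cos phi, y0 + sin phi).

Definition rot_about (e : pt) (beta : R) (p : pt) : pt :=
  (fst e + cos beta * (fst p - fst e) - sin beta * (snd p - snd e),
   snd e + sin beta * (fst p - fst e) + cos beta * (snd p - snd e)).

Definition image (f : pt -> pt) (A : pt -> Prop) (q : pt) : Prop :=
  exists p, A p /\ f p = q.

Definition swept (g : motion) (A : pt -> Prop) (q : pt) : Prop :=
  exists t, 0 <= t <= 1 /\ image (gmap g t) A q.

(* Lebesgue (outer) measure of E is < eps: by definition of the outer
   measure as the infimum of total areas of countable covers by rectangles
   [x1,x2] x [y1,y2]. *)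
Definition rect_area (r : R * R * R * R) : R :=
  let '(x1, x2, y1, y2) := r in (x2 - x1) * (y2 - y1).

Definition in_rect (r : R * R * R * R) (q : pt) : Prop :=
  let '(x1, x2, y1, y2) := r in x1 <= fst q <= x2 /\ y1 <= snd q <= y2.

Definition measure_lt (E : pt -> Prop) (eps : R) : Prop :=
  exists (rs : nat -> R * R * R * R) (S : R),
    (forall n, let '(x1, x2, y1, y2) := rs n in x1 <= x2 /\ y1 <= y2) /\
    (forall q, E q -> exists n, in_rect (rs n) q) /\
    (forall N, sum_f_R0 (fun n => rect_area (rs n)) N <= S) /\
    S < eps.

(* Main.v *)
(** Sliding an arc along its own circle costs no area, so only the displacement
    of the centre matters.  Let [K] be the best constant such that displacing the
    centre by a vector [v] costs area at most [K |v|].  With [L < W < PI / 2], let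
    [V(psi)], for [psi] decreasing from [W] to [0], run through the vectors of
    direction [psi] (relative to [V(0)]) ending on the line perpendicular to
    [V(0)], with [V(W) = v]; this line segment has length [|v| sin W].  Passing
    from [V(psi)] to [V(psi - De)] by ever finer zigzags, whose second strokes are
    parallel to that line, each scale makes the circles swept along the first
    strokes overlap almost completely at the angles between [psi - De] and [psi].
    In the limit the first strokes are free at a fixed angular position of the
    arc, and the second strokes have total length [|v| sin W].  Hence
    [K <= K sin W], and [K = 0]. *)

Require Import Defs.
From Stdlib Require Import Reals.
From Stdlib Require Import Lra Lia List.
From Coquelicot Require Import Rcomplements.
Import ListNotations.
Open Scope R_scope.

(** * Finite covers by squares, and first-order estimates on the circle *)

Definition covered (l : list (R * R * R)) (x y : R) : Prop :=
  exists a b r, In (a, b, r) l /\ Rabs (x - a) <= r /\ Rabs (y - b) <= r.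

(** A quarter of the total area, [r] being half a side; the factor 4 returns in
    [covered_measure_lt]. *)
Fixpoint weight (l : list (R * R * R)) : R :=
  match l with
  | [] => 0
  | (_, r) :: l' => r ^ 2 + weight l'
  end.

Lemma weight_app l1 l2 : weight (l1 ++ l2) = weight l1 + weight l2.
Proof.
  induction l1 as [|[c r] l1 IH]; simpl; [lra|rewrite IH; ring].
Qed.

Lemma covered_incl l1 l2 x y : incl l1 l2 -> covered l1 x y -> covered l2 x y.
Proof.
  intros H (a & b & r & Hin & Hr); exists a, b, r; auto.
Qed.

Lemma cos_sub_le a b : Rabs (cos a - cos b) <= Rabs (a - b).
Proof.
  destruct (MVT_abs cos (fun x => - sin x) b a) as (c & Hc & _).
  { intros; apply derivable_pt_lim_cos. }
  rewrite Hc, Rabs_Ropp.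
  assert (Rabs (sin c) <= 1) by (apply Rabs_le; pose proof (SIN_bound c); lra).
  pose proof (Rabs_pos (a - b)); nra.
Qed.

Lemma sin_sub_le a b : Rabs (sin a - sin b) <= Rabs (a - b).
Proof.
  rewrite <- !cos_shift.
  replace (a - b) with (- ((PI / 2 - a) - (PI / 2 - b))) by ring.
  rewrite Rabs_Ropp; apply cos_sub_le.
Qed.

(** The derivative is frozen at a reference angle [xi]: the mean value theorem evaluates it within
    [mu + Rabs (phi - xi)] of [xi], and sine is 1-Lipschitz. *)
Lemma cos_affine_le phi mu xi : 0 <= mu ->
  Rabs (cos (phi + mu) - cos phi + mu * sin xi) <= mu * (mu + Rabs (phi - xi)).
Proof.
  intros Hmu.
  destruct (Req_dec mu 0) as [->|Hne].
  { rewrite Rplus_0_r; replace (_ + _) with 0 by ring; rewrite Rabs_R0; lra. }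
  destruct (MVT_cor2 cos (fun x => - sin x) phi (phi + mu)) as (c & Hc & Hb).
  { lra. } { intros; apply derivable_pt_lim_cos. }
  rewrite Hc; replace (_ + _) with (mu * (sin xi - sin c)) by ring.
  rewrite Rabs_mult, (Rabs_right mu) by lra.
  apply Rmult_le_compat_l; [lra|].
  eapply Rle_trans; [apply sin_sub_le|].
  revert Hb; unfold Rabs; repeat destruct Rcase_abs; lra.
Qed.

Lemma sin_affine_le phi mu xi : 0 <= mu ->
  Rabs (sin (phi + mu) - sin phi - mu * cos xi) <= mu * (mu + Rabs (phi - xi)).
Proof.
  intros Hmu.
  pose proof (cos_affine_le (phi - PI / 2) mu (xi - PI / 2) Hmu) as H.
  replace (phi - PI / 2 + mu) with (- (PI / 2 - (phi + mu))) in H by ring.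
  replace (cos (phi - PI / 2)) with (sin phi) in H
    by (rewrite <- cos_shift, <- cos_neg; f_equal; ring).
  replace (sin (xi - PI / 2)) with (- cos xi) in H
    by (rewrite <- sin_shift, <- sin_neg; f_equal; ring).
  rewrite cos_neg, cos_shift in H.
  replace (phi - PI / 2 - (xi - PI / 2)) with (phi - xi) in H by ring.
  replace (sin (phi + mu) - sin phi - mu * cos xi)
    with (sin (phi + mu) - sin phi + mu * - cos xi) by ring.
  exact H.
Qed.

(** Squares of half-side [2 * tau] centred on the arc at angular spacing [tau] suffice: one [tau]
    for the angular gap, one for the distance to the arc. There are at most [(b - a) / tau + 1] of
    them. *)
Lemma arc_neighbourhood_cover x y a b tau : 0 < tau -> a <= b ->
  exists l, weight l <= 4 * (tau * (b - a) + tau ^ 2) /\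
    forall phi px py, a <= phi <= b ->
      Rabs (px - (x + cos phi)) <= tau -> Rabs (py - (y + sin phi)) <= tau ->
      covered l px py.
Proof.
  intros Htau Hab.
  assert (Haux : forall m : nat, exists l,
    weight l = 4 * tau ^ 2 * INR m /\
    forall phi px py, a <= phi < a + INR m * tau ->
      Rabs (px - (x + cos phi)) <= tau -> Rabs (py - (y + sin phi)) <= tau ->
      covered l px py).
  { induction m as [|m (l & Hw & Hl)].
    - exists []; simpl; split; [lra|intros; lra].
    - exists ((x + cos (a + INR m * tau), y + sin (a + INR m * tau), 2 * tau) :: l).
      rewrite S_INR; split.
      + cbn [weight]; rewrite Hw; ring.
      + intros phi px py Hphi Hx Hy.
        destruct (Rlt_le_dec phi (a + INR m * tau)) as [Hlt|Hge].
        * apply (covered_incl l); [apply incl_tl, incl_refl|].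
          apply (Hl phi); auto; lra.
        * eexists _, _, _; split; [left; reflexivity|].
          pose proof (cos_sub_le phi (a + INR m * tau)) as Hc.
          pose proof (sin_sub_le phi (a + INR m * tau)) as Hs.
          rewrite (Rabs_right (phi - _)) in Hc, Hs by lra.
          revert Hx Hy Hc Hs; unfold Rabs; repeat destruct Rcase_abs; lra. }
  destruct (nfloor_ex ((b - a) / tau)) as (m & Hm1 & Hm2).
  { apply Rdiv_le_0_compat; lra. }
  assert (Hq : (b - a) / tau * tau = b - a) by (field; lra).
  destruct (Haux (S m)) as (l & Hw & Hl); rewrite S_INR in Hw, Hl.
  exists l; split.
  - rewrite Hw. assert (INR m * tau <= b - a) by nra. nra.
  - intros phi px py Hphi; apply Hl; split; [lra|nra].
Qed.

(** * Paths of centres and angular positions *)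

(** A placement of the arc is its centre together with the real angle at which it starts; [E] must
    hold at every placement along the path. The paths are total functions so that the global
    [continuity] applies to them. *)
Definition reach (E : R -> R -> R -> Prop) (x y th x' y' th' : R) : Prop :=
  exists X Y T : R -> R,
    (continuity X /\ continuity Y /\ continuity T) /\
    (X 0 = x /\ Y 0 = y /\ T 0 = th) /\
    (X 1 = x' /\ Y 1 = y' /\ T 1 = th') /\
    forall t, 0 <= t <= 1 -> E (X t) (Y t) (T t).

Lemma reach_weaken (E F : R -> R -> R -> Prop) x y th x' y' th' :
  (forall a b c, E a b c -> F a b c) ->
  reach E x y th x' y' th' -> reach F x y th x' y' th'.
Proof.
  intros H (X & Y & T & HC & H0 & H1 & HE); exists X, Y, T; auto 10.
Qed.

Lemma continuity_affine a b : continuity (fun t => a + t * b).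
Proof.
  apply derivable_continuous; intros t.
  exists (0 + (1 * b + t * 0)).
  apply (derivable_pt_lim_plus (fun _ => a) (fun t => t * b)).
  - apply derivable_pt_lim_const.
  - apply (derivable_pt_lim_mult (fun t => t) (fun _ => b)).
    + apply derivable_pt_lim_id.
    + apply derivable_pt_lim_const.
Qed.

Lemma reach_line (E : R -> R -> R -> Prop) x y th x' y' th' :
  (forall t, 0 <= t <= 1 ->
     E (x + t * (x' - x)) (y + t * (y' - y)) (th + t * (th' - th))) ->
  reach E x y th x' y' th'.
Proof.
  intros H.
  exists (fun t => x + t * (x' - x)), (fun t => y + t * (y' - y)),
    (fun t => th + t * (th' - th)).
  repeat split; try apply continuity_affine; try ring; auto.
Qed.

(* Both halves are clamped to [0,1], so that a sum replaces the case split at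
   t = 1/2 and continuity is immediate. *)
Definition glue (f g : R -> R) (t : R) : R :=
  f (1 / 2 + t * 1 - Rabs (- (1 / 2) + t * 1)) +
  g (- (1 / 2) + t * 1 + Rabs (- (1 / 2) + t * 1)) - f 1.

Lemma continuity_glue f g : continuity f -> continuity g -> continuity (glue f g).
Proof.
  intros Hf Hg.
  assert (Ha : continuity (fun t => Rabs (- (1 / 2) + t * 1))).
  { apply (continuity_comp (fun t => - (1 / 2) + t * 1) Rabs).
    - apply continuity_affine.
    - exact Rcontinuity_abs. }
  apply (continuity_minus (fun t =>
    f (1 / 2 + t * 1 - Rabs (- (1 / 2) + t * 1)) +
    g (- (1 / 2) + t * 1 + Rabs (- (1 / 2) + t * 1))) (fun _ => f 1)).
  - apply (continuity_plus
      (fun t => f (1 / 2 + t * 1 - Rabs (- (1 / 2) + t * 1)))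
      (fun t => g (- (1 / 2) + t * 1 + Rabs (- (1 / 2) + t * 1)))).
    + apply (continuity_comp
        (fun t => 1 / 2 + t * 1 - Rabs (- (1 / 2) + t * 1)) f); [|exact Hf].
      apply (continuity_minus (fun t => 1 / 2 + t * 1)); [|exact Ha].
      apply continuity_affine.
    + apply (continuity_comp
        (fun t => - (1 / 2) + t * 1 + Rabs (- (1 / 2) + t * 1)) g); [|exact Hg].
      apply (continuity_plus (fun t => - (1 / 2) + t * 1)); [|exact Ha].
      apply continuity_affine.
  - apply continuity_const; intros u v; reflexivity.
Qed.

Lemma glue_left f g t : f 1 = g 0 -> t <= 1 / 2 -> glue f g t = f (2 * t).
Proof.
  intros H Ht; unfold glue; rewrite Rabs_left1 by lra.
  replace (1 / 2 + t * 1 - _) with (2 * t) by ring.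
  replace (- (1 / 2) + t * 1 + _) with 0 by ring.
  rewrite H; ring.
Qed.

Lemma glue_right f g t : 1 / 2 <= t -> glue f g t = g (2 * t - 1).
Proof.
  intros Ht; unfold glue; rewrite Rabs_right by lra.
  replace (1 / 2 + t * 1 - _) with 1 by field.
  replace (- (1 / 2) + t * 1 + _) with (2 * t - 1) by field.
  ring.
Qed.

Lemma reach_trans E x y th x' y' th' x'' y'' th'' :
  reach E x y th x' y' th' -> reach E x' y' th' x'' y'' th'' ->
  reach E x y th x'' y'' th''.
Proof.
  intros (X & Y & T & (CX & CY & CT) & (X0 & Y0 & T0) & (X1 & Y1 & T1) & HE)
    (X' & Y' & T' & (CX' & CY' & CT') & (X0' & Y0' & T0') & (X1' & Y1' & T1') & HE').
  exists (glue X X'), (glue Y Y'), (glue T T').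
  assert (EX : X 1 = X' 0) by congruence.
  assert (EY : Y 1 = Y' 0) by congruence.
  assert (ET : T 1 = T' 0) by congruence.
  split; [auto using continuity_glue|].
  split; [rewrite !glue_left, Rmult_0_r by (auto; lra); auto|].
  split.
  { rewrite !glue_right by lra.
    replace (2 * 1 - 1) with 1 by ring; auto. }
  intros t Ht; destruct (Rle_lt_dec t (1 / 2)).
  - rewrite !glue_left by auto; apply HE; lra.
  - rewrite !glue_right by lra; apply HE'; lra.
Qed.

Lemma reach_iter (E : list (R * R * R) -> R -> R -> R -> Prop)
    (xs ys : nat -> R) th c (m : nat) :
  (forall l l' x y t, incl l l' -> E l x y t -> E l' x y t) ->
  (forall i, (i <= m)%nat -> exists l, weight l <= c /\
     reach (E l) (xs i) (ys i) th (xs (S i)) (ys (S i)) th) ->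
  exists l, weight l <= INR (S m) * c /\
     reach (E l) (xs O) (ys O) th (xs (S m)) (ys (S m)) th.
Proof.
  intros Hmono; induction m as [|m IH]; intros Hstep.
  - destruct (Hstep O) as (l & Hw & Hl); [lia|].
    exists l; split; [simpl; lra|exact Hl].
  - destruct IH as (l & Hw & Hl); [intros; apply Hstep; lia|].
    destruct (Hstep (S m)) as (l' & Hw' & Hl'); [lia|].
    exists (l ++ l'); split.
    + rewrite weight_app, S_INR; lra.
    + eapply reach_trans.
      * eapply reach_weaken; [|exact Hl].
        intros a b d; apply Hmono, incl_appl, incl_refl.
      * eapply reach_weaken; [|exact Hl'].
        intros a b d; apply Hmono, incl_appr, incl_refl.
Qed.

(** * The cost of displacing the centre *)

Definition arc_covered (L : R) (l : list (R * R * R)) (x y th : R) : Prop :=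
  forall phi, th <= phi <= th + L -> covered l (x + cos phi) (y + sin phi).

Lemma arc_covered_incl L l l' x y th :
  incl l l' -> arc_covered L l x y th -> arc_covered L l' x y th.
Proof.
  intros H Hl phi Hphi; exact (covered_incl _ _ _ _ H (Hl phi Hphi)).
Qed.

(** The angles [th] and [th'] are arbitrary because sliding is free up to [delta]. The bound [l0] is
    there because the constructions work for short displacements; [displacement_cost_subdivide]
    removes it. *)
Definition displacement_cost (L K l0 : R) : Prop :=
  forall x y th th' be len delta, 0 <= len <= l0 -> 0 < delta ->
  exists l, weight l <= K * len + delta /\
    reach (arc_covered L l) x y th (x + len * cos be) (y + len * sin be) th'.

Lemma small_neighbourhood_cost (len delta : R) : 0 <= len -> 0 < delta ->
  exists tau, 0 < tau /\ 4 * (tau * len + tau ^ 2) <= delta.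
Proof.
  intros Hlen Hd.
  (* The summand [delta] forces [delta / k <= 1], so [tau ^ 2 <= tau] and the cost is at most
     [4 * (len + 1) * tau]. *)
  set (k := 4 * (len + 1) + delta).
  assert (Hk : 0 < k) by (unfold k; lra).
  assert (Hkd : delta / k * k = delta) by (field; lra).
  assert (Hpos : 0 < delta / k) by (apply Rdiv_lt_0_compat; lra).
  assert (Hle : delta / k <= 1) by (unfold k in *; nra).
  exists (delta / k); split; [exact Hpos|].
  unfold k in *; nra.
Qed.

(** All placements lie on one fixed arc of the circle, which has arbitrarily thin neighbourhoods. *)
Lemma slide L x y th th' delta : 0 <= L -> 0 < delta ->
  exists l, weight l <= delta /\ reach (arc_covered L l) x y th x y th'.
Proof.
  intros HL Hd.
  set (a := Rmin th th'); set (b := Rmax th th' + L).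
  assert (Hab : a <= b /\ a <= th /\ a <= th' /\ th + L <= b /\ th' + L <= b).
  { unfold a, b.
    pose proof (Rmin_l th th'); pose proof (Rmin_r th th').
    pose proof (Rmax_l th th'); pose proof (Rmax_r th th'); lra. }
  destruct (small_neighbourhood_cost (b - a) delta) as (tau & Ht & Hw); [lra..|].
  destruct (arc_neighbourhood_cover x y a b tau) as (l & Hl & Hc); [lra..|].
  exists l; split; [lra|].
  apply reach_line; intros t Ht1 phi Hphi.
  replace (x + t * (x - x)) with x by ring.
  replace (y + t * (y - y)) with y by ring.
  apply (Hc phi).
  - nra.
  - rewrite Rminus_diag, Rabs_R0; lra.
  - rewrite Rminus_diag, Rabs_R0; lra.
Qed.

(** The cost is linear in the length, so equal steps of length at most [l0] add up without loss; the
    angle stays [th] until a final slide. *)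
Lemma displacement_cost_subdivide L K l0 l1 : 0 <= L -> 0 < l0 ->
  displacement_cost L K l0 -> displacement_cost L K l1.
Proof.
  intros HL Hl0 H x y th th' be len delta Hlen Hd.
  destruct (nfloor_ex (len / l0)) as (m & _ & Hm).
  { apply Rdiv_le_0_compat; lra. }
  assert (Hq : len / l0 * l0 = len) by (field; lra).
  rewrite <- S_INR in Hm.
  assert (HS : 0 < INR (S m)) by (apply lt_0_INR; lia).
  set (n := INR (S m)) in *.
  set (h := len / n).
  assert (Hh : h * n = len) by (unfold h; field; lra).
  assert (Hh0 : 0 <= h <= l0) by nra.
  assert (Hdn : 0 < delta / 2 / n) by (repeat apply Rdiv_lt_0_compat; lra).
  destruct (reach_iter (arc_covered L)
    (fun i => x + INR i * h * cos be) (fun i => y + INR i * h * sin be) th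
    (K * h + delta / 2 / n) m) as (l & Hw & Hl).
  { intros; eapply arc_covered_incl; eauto. }
  { intros i _.
    destruct (H (x + INR i * h * cos be) (y + INR i * h * sin be) th th be h
      (delta / 2 / n)) as (l & Hw & Hl); auto.
    exists l; split; [exact Hw|].
    rewrite S_INR.
    replace (x + (INR i + 1) * h * cos be)
      with (x + INR i * h * cos be + h * cos be) by ring.
    replace (y + (INR i + 1) * h * sin be)
      with (y + INR i * h * sin be + h * sin be) by ring.
    exact Hl. }
  cbn beta in Hl; fold n in Hw, Hl.
  rewrite (Rmult_comm n h), Hh in Hl.
  change (INR 0) with 0 in Hl.
  rewrite !Rmult_0_l, !Rplus_0_r in Hl.
  destruct (slide L (x + len * cos be) (y + len * sin be) th th' (delta / 2))
    as (l' & Hw' & Hl'); [lra..|].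
  exists (l ++ l'); split.
  - rewrite weight_app.
    replace (n * (K * h + delta / 2 / n)) with (K * (h * n) + delta / 2)
      in Hw by (field; lra).
    rewrite Hh in Hw; lra.
  - eapply reach_trans.
    + eapply reach_weaken; [|exact Hl].
      intros a b d; apply arc_covered_incl, incl_appl, incl_refl.
    + eapply reach_weaken; [|exact Hl'].
      intros a b d; apply arc_covered_incl, incl_appr, incl_refl.
Qed.

Lemma Rabs_scal_le t r c : 0 <= t <= 1 -> 0 <= r -> -1 <= c <= 1 ->
  Rabs (t * (r * c)) <= r.
Proof.
  intros Ht Hr Hc; assert (- r <= r * c <= r) by nra.
  apply Rabs_le; nra.
Qed.

(** A straight translation stays in the [len]-neighbourhood of the initial arc, and
    [len ^ 2 <= len]. This crude constant starts the iteration. *)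
Lemma displacement_cost_translation L : 0 <= L ->
  displacement_cost L (4 * (L + 1)) 1.
Proof.
  intros HL x y th th' be len delta Hlen Hd.
  destruct (slide L (x + len * cos be) (y + len * sin be) th th' (delta / 2))
    as (l' & Hw' & Hl'); [lra..|].
  assert (Htr : exists l, weight l <= 4 * (L + 1) * len + delta / 2 /\
    reach (arc_covered L l) x y th (x + len * cos be) (y + len * sin be) th).
  { destruct (Req_dec len 0) as [->|Hne].
    - destruct (slide L x y th th (delta / 2)) as (l & Hw & Hl); [lra..|].
      exists l; rewrite !Rmult_0_l, !Rplus_0_r; split; [lra|exact Hl].
    - destruct (arc_neighbourhood_cover x y th (th + L) len) as (l & Hw & Hc);
        [lra..|].
      exists l; split; [nra|].
      apply reach_line; intros t Ht phi Hphi.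
      apply (Hc phi); [lra| |].
      + replace (x + t * (x + len * cos be - x) + cos phi - (x + cos phi))
          with (t * (len * cos be)) by ring.
        apply Rabs_scal_le; [lra|lra|apply COS_bound].
      + replace (y + t * (y + len * sin be - y) + sin phi - (y + sin phi))
          with (t * (len * sin be)) by ring.
        apply Rabs_scal_le; [lra|lra|apply SIN_bound]. }
  destruct Htr as (l & Hw & Hl).
  exists (l ++ l'); split; [rewrite weight_app; lra|].
  eapply reach_trans.
  - eapply reach_weaken; [|exact Hl].
    intros a b d; apply arc_covered_incl, incl_appl, incl_refl.
  - eapply reach_weaken; [|exact Hl'].
    intros a b d; apply arc_covered_incl, incl_appr, incl_refl.
Qed.

(** * The zigzag *)

(** With [zig_y]: [s] times the unit tangent at the angle [al], minus [s * tan psi] times the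
    outward unit radius there. The vector is tangent to the circle at [al + psi], has length
    [s / cos psi], and for fixed [s] its end moves along a radial line as [psi] varies. *)
Definition zig_x (al psi s : R) : R := s * (- sin al - tan psi * cos al).
Definition zig_y (al psi s : R) : R := s * (cos al - tan psi * sin al).

Lemma zig_x_polar al psi s : cos psi <> 0 ->
  zig_x al psi s = s / cos psi * - sin (al + psi).
Proof.
  intros H; unfold zig_x, tan; rewrite sin_plus; field; exact H.
Qed.

Lemma zig_y_polar al psi s : cos psi <> 0 ->
  zig_y al psi s = s / cos psi * cos (al + psi).
Proof.
  intros H; unfold zig_y, tan; rewrite cos_plus; field; exact H.
Qed.

Lemma cos_inv_le psi W : 0 <= psi <= W -> W < PI / 2 ->
  0 < cos psi /\ 0 < / cos psi <= / cos W.
Proof.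
  intros Hp HW.
  assert (Hc : 0 < cos W) by (apply cos_gt_0; lra).
  assert (Hle : cos W <= cos psi) by (apply cos_decr_1; lra).
  split; [lra|split].
  - apply Rinv_0_lt_compat; lra.
  - apply Rinv_le_contravar; lra.
Qed.

(* Moving the centre along a direction that is almost tangent to the circle at
   the angle [phi] moves the point at [phi] almost along the circle itself. *)
Lemma strip_cover W De al psi s ox oy :
  0 < De <= 1 -> De <= psi <= W -> W < PI / 2 -> 0 < s -> s * / cos W <= De ->
  exists l, weight l <= s * (60 * / cos W * De ^ 2) /\
    forall u phi px py, 0 <= u <= 1 -> al + psi - De <= phi <= al + psi ->
      Rabs (px - (ox + u * zig_x al psi s)) <= s * / cos W * De ->
      Rabs (py - (oy + u * zig_y al psi s)) <= s * / cos W * De ->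
      covered l (px + cos phi) (py + sin phi).
Proof.
  intros HDe Hpsi HW Hs HsDe.
  destruct (cos_inv_le psi W) as (Hc & Hi & Hle); [lra..|].
  set (q := / cos W) in *.
  set (la := s / cos psi).
  assert (Hla : 0 < la <= s * q) by (unfold la, Rdiv; split; nra).
  assert (Hq : 0 < s * q * De) by (apply Rmult_lt_0_compat; lra).
  (* Of the factor 3, one unit is the tolerance on the centre and two bound the first-order error
     [Herr]. The interval is lengthened by [la] because points slide forward by up to [la]. *)
  destruct (arc_neighbourhood_cover ox oy (al + psi - De) (al + psi + la)
    (3 * (s * q * De))) as (l & Hw & Hl); [lra..|].
  exists l; split.
  (* The constant is 60 = 4 * (3 * 2 + 9), from [la + De <= 2 * De] and [s * q * De <= De]. *)
  { eapply Rle_trans; [exact Hw|].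
    replace (al + psi + la - (al + psi - De)) with (la + De) by ring.
    assert (s * q * De * (la + De) <= s * q * De * (2 * De))
      by (apply Rmult_le_compat_l; lra).
    assert (s * q * De * (s * q * De) <= s * q * De * De)
      by (apply Rmult_le_compat_l; [lra|];
          rewrite <- (Rmult_1_l De) at 2; apply Rmult_le_compat_r; lra).
    nra. }
  intros u phi px py Hu Hphi Hx Hy.
  rewrite zig_x_polar in Hx by lra; rewrite zig_y_polar in Hy by lra.
  fold la in Hx, Hy.
  set (mu := u * la).
  assert (Hmu : 0 <= mu <= la) by (unfold mu; nra).
  assert (Herr : mu * (mu + Rabs (phi - (al + psi))) <= 2 * (s * q * De)).
  { assert (Rabs (phi - (al + psi)) <= De) by (apply Rabs_le; lra).
    pose proof (Rabs_pos (phi - (al + psi))).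
    assert (mu * (mu + Rabs (phi - (al + psi))) <= s * q * (2 * De))
      by (apply Rmult_le_compat; lra).
    lra. }
  pose proof (Rle_trans _ _ _ (cos_affine_le phi mu (al + psi) (proj1 Hmu)) Herr) as H1.
  pose proof (Rle_trans _ _ _ (sin_affine_le phi mu (al + psi) (proj1 Hmu)) Herr) as H2.
  replace (u * (la * - sin (al + psi))) with (- (mu * sin (al + psi))) in Hx
    by (unfold mu; ring).
  replace (u * (la * cos (al + psi))) with (mu * cos (al + psi)) in Hy
    by (unfold mu; ring).
  (* The point at [phi] on the displaced circle is compared with the point at [phi + mu] on the
     original one. *)
  apply (Hl (phi + mu)); [lra| |].
  - revert Hx H1; unfold Rabs; repeat destruct Rcase_abs; lra.
  - revert Hy H2; unfold Rabs; repeat destruct Rcase_abs; lra.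
Qed.

(* States of a partially processed piece: at angular position [al] only the
   angles below [al + w] are covered, the rest being left to the coarser pieces
   that contain it. *)
Definition piece_state (L al rho w : R) (l : list (R * R * R)) (ox oy : R)
    (x y th : R) : Prop :=
  arc_covered L l x y th \/
  th = al /\ Rabs (x - ox) <= rho /\ Rabs (y - oy) <= rho /\
  forall phi, al <= phi < al + w -> covered l (x + cos phi) (y + sin phi).

Lemma piece_state_incl L al rho w l l' ox oy x y th : incl l l' ->
  piece_state L al rho w l ox oy x y th -> piece_state L al rho w l' ox oy x y th.
Proof.
  intros H [Ha|(Ht & Hx & Hy & Hc)].
  - left; eapply arc_covered_incl; eauto.
  - right; repeat split; auto.
    intros phi Hphi; eapply covered_incl; eauto.
Qed.

(** Induction on the number [n] of strips of width [De]. The stroke at angle [psi = (n + 1) * De] is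
    cut into [S m] equal steps; each is an inductive piece at angle [n * De] and scale [s / N],
    followed by a radial stroke paid for by [K]. One [strip_cover] serves the new strip in all the
    steps. The radial costs telescope to [K * s * tan psi], and every level adds one strip of weight
    [s * (60 * / cos W * De ^ 2)]. *)
Lemma zigzag_piece L K W De al (m : nat) :
  (forall l0, displacement_cost L K l0) ->
  0 < De <= 1 -> 0 < W < PI / 2 -> 2 <= INR (S m) * De ->
  forall n : nat, INR n * De <= W ->
  forall s ox oy delta, 0 < s -> s * / cos W <= De -> 0 < delta ->
  exists l,
    weight l <= s * (INR n * (60 * / cos W * De ^ 2) + K * tan (INR n * De)) + delta /\
    reach (piece_state L al (2 * (s * / cos W)) (INR n * De) l ox oy)
      ox oy al (ox + zig_x al (INR n * De) s) (oy + zig_y al (INR n * De) s) al.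
Proof.
  intros HK HDe HW Hm.
  assert (HN : 0 < INR (S m)) by (apply lt_0_INR; lia).
  set (N := INR (S m)) in *.
  assert (HN2 : 2 <= N) by nra.
  destruct (cos_inv_le 0 W) as (_ & _ & Hq1); [lra..|].
  rewrite cos_0, Rinv_1 in Hq1.
  set (q := / cos W) in *.
  induction n as [|n IH]; intros Hn s ox oy delta Hs HsDe Hd.
  (* At width 0 no angle has to be covered, so a straight stroke is free. *)
  { exists []; split.
    - change (INR 0) with 0; rewrite !Rmult_0_l, tan_0; cbn [weight]; lra.
    - apply reach_line; intros t Ht; right.
      change (INR 0) with 0; unfold zig_x, zig_y; rewrite !Rmult_0_l, tan_0.
      split; [ring|split; [|split]].
      + replace (_ - ox) with (t * (s * - sin al)) by ring.
        eapply Rle_trans; [apply Rabs_scal_le|nra]; [lra|lra|].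
        pose proof (SIN_bound al); lra.
      + replace (_ - oy) with (t * (s * cos al)) by ring.
        eapply Rle_trans; [apply Rabs_scal_le|nra]; [lra|lra|].
        apply COS_bound.
      + intros; lra. }
  pose proof (pos_INR n) as Hn0.
  rewrite S_INR in *.
  set (psi := (INR n + 1) * De) in *.
  assert (Hpsi : psi = INR n * De + De) by (unfold psi; ring).
  assert (Hpsi0 : 0 <= INR n * De) by nra.
  assert (Htan : tan (INR n * De) < tan psi) by (apply tan_increasing; lra).
  destruct (cos_inv_le psi W) as (Hc & Hi & Hle); [lra..|].
  fold q in Hle.
  destruct (strip_cover W De al psi s ox oy) as (ls & Hws & Hls); try lra.
  { exact HsDe. }
  fold q in Hws, Hls.
  assert (HsN : s / N * N = s) by (field; lra).
  assert (HsN0 : 0 < s / N) by (apply Rdiv_lt_0_compat; lra).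
  (* This is where [2 <= N * De] enters: the excursion of a small piece fits within the tolerance of
     [strip_cover]. *)
  assert (HsNq : 2 * (s / N * q) <= s * q * De).
  { replace (s * q * De) with (s / N * q * (N * De)) by (field; lra).
    rewrite (Rmult_comm 2); apply Rmult_le_compat_l; [nra|lra]. }
  assert (HdN : 0 < delta / 2 / N) by (repeat apply Rdiv_lt_0_compat; lra).
  (* The common cover [ls] is built into [E], so the iteration pays for it once rather than at each
     of the [N] steps. *)
  set (E := fun l => piece_state L al (2 * (s * q)) psi (ls ++ l) ox oy).
  set (len := s / N * (tan psi - tan (INR n * De))).
  assert (Hlen : 0 <= len) by (apply Rmult_le_pos; lra).
  destruct (reach_iter E
    (fun i => ox + INR i * zig_x al psi (s / N))
    (fun i => oy + INR i * zig_y al psi (s / N)) al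
    (s / N * (INR n * (60 * q * De ^ 2) + K * tan (INR n * De)) + delta / 2 / N
     + (K * len + delta / 2 / N)) m) as (l & Hw & Hl).
  { intros l l' x y t Hincl; apply piece_state_incl.
    apply incl_app; [apply incl_appl, incl_refl|apply incl_appr, Hincl]. }
  { intros i Hi_m.
    set (xi := ox + INR i * zig_x al psi (s / N)).
    set (yi := oy + INR i * zig_y al psi (s / N)).
    destruct (IH ltac:(lra) (s / N) xi yi (delta / 2 / N)) as (lp & Hwp & Hlp);
      [lra|nra|lra|].
    (* The radial stroke, in the inward direction [al + PI], restores the end of a step to the line
       of angle [psi]. *)
    destruct (HK len (xi + zig_x al (INR n * De) (s / N))
      (yi + zig_y al (INR n * De) (s / N)) al al (al + PI) len (delta / 2 / N))
      as (lb & Hwb & Hlb); [lra..|].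
    exists (lp ++ lb); split; [rewrite weight_app; lra|].
    eapply reach_trans.
    - eapply reach_weaken; [|exact Hlp].
      intros x y th [Ha|(-> & Hx & Hy & Hcv)].
      + left; revert Ha.
        apply arc_covered_incl, incl_appr, incl_appl, incl_refl.
      + right.
        (* The step starts at the fraction [u] of the long stroke, and its small piece stays near
           that point. *)
        set (u := INR i / N).
        assert (Hu : 0 <= u <= 1).
        { assert (INR i <= N) by (apply le_INR; lia).
          pose proof (pos_INR i).
          assert (u * N = INR i) by (unfold u; field; lra).
          split; nra. }
        assert (Hx' : Rabs (x - (ox + u * zig_x al psi s)) <= s * q * De).
        { replace (ox + u * zig_x al psi s) with xi
            by (unfold xi, u, zig_x; field; lra). lra. }
        assert (Hy' : Rabs (y - (oy + u * zig_y al psi s)) <= s * q * De).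
        { replace (oy + u * zig_y al psi s) with yi
            by (unfold yi, u, zig_y; field; lra). lra. }
        assert (Hr : s * q * De <= s * q)
          by (rewrite <- (Rmult_1_r (s * q)) at 2; apply Rmult_le_compat_l; nra).
        assert (Hla : s / cos psi <= s * q)
          by (unfold Rdiv; apply Rmult_le_compat_l; lra).
        assert (Hla0 : 0 <= s / cos psi)
          by (apply Rlt_le, Rdiv_lt_0_compat; lra).
        split; [reflexivity|split; [|split]].
        * assert (Hz : Rabs (u * zig_x al psi s) <= s / cos psi).
          { rewrite zig_x_polar by lra; apply Rabs_scal_le; [lra|lra|].
            pose proof (SIN_bound (al + psi)); lra. }
          revert Hx' Hz; unfold Rabs; repeat destruct Rcase_abs; lra.
        * assert (Hz : Rabs (u * zig_y al psi s) <= s / cos psi).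
          { rewrite zig_y_polar by lra; apply Rabs_scal_le; [lra|lra|].
            apply COS_bound. }
          revert Hy' Hz; unfold Rabs; repeat destruct Rcase_abs; lra.
        * intros phi Hphi.
          (* Angles below the last strip come from the inductive cover, those in it from the shared
             one. *)
          destruct (Rlt_le_dec phi (al + INR n * De)) as [Hlt|Hge].
          -- apply (covered_incl lp);
               [apply incl_appr, incl_appl, incl_refl|apply Hcv; lra].
          -- apply (covered_incl ls); [apply incl_appl, incl_refl|].
             apply (Hls u); auto; lra.
    - replace (ox + INR (S i) * zig_x al psi (s / N))
        with (xi + zig_x al (INR n * De) (s / N) + len * cos (al + PI))
        by (rewrite neg_cos, S_INR; unfold xi, len, zig_x; ring).
      replace (oy + INR (S i) * zig_y al psi (s / N))
        with (yi + zig_y al (INR n * De) (s / N) + len * sin (al + PI))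
        by (rewrite neg_sin, S_INR; unfold yi, len, zig_y; ring).
      eapply reach_weaken; [|exact Hlb].
      intros x y th Ha; left; revert Ha.
      apply arc_covered_incl, incl_appr, incl_appr, incl_refl. }
  exists (ls ++ l); split.
  - rewrite weight_app; fold N in Hw.
    replace (N * _) with (s / N * N * (INR n * (60 * q * De ^ 2)
      + K * tan (INR n * De) + K * (tan psi - tan (INR n * De))) + delta)
      in Hw by (unfold len; field; lra).
    rewrite HsN in Hw; lra.
  - cbn beta in Hl; fold N in Hl; change (INR 0) with 0 in Hl.
    rewrite !Rmult_0_l, !Rplus_0_r in Hl.
    replace (zig_x al psi s) with (N * zig_x al psi (s / N))
      by (unfold zig_x; field; lra).
    replace (zig_y al psi s) with (N * zig_y al psi (s / N))
      by (unfold zig_y; field; lra).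
    exact Hl.
Qed.

(** With [S M] strips making up [W > L], a piece covers the whole arc. Taking [s = len * cos W]
    turns the radial cost [K * s * tan W] into [len * sin W * K], while the strips total
    [60 * W * De * len]. *)
Lemma displacement_cost_zigzag L K W eta :
  0 <= L < W -> W < PI / 2 -> 0 < eta ->
  (forall l0, displacement_cost L K l0) ->
  forall l0, displacement_cost L (sin W * K + eta) l0.
Proof.
  intros HL HW Heta HK l1.
  (* The first summand makes the strips cost at most [eta] per unit length; the second gives
     [De <= 1]. *)
  destruct (nfloor_ex (60 * W * W / eta + W)) as (M & _ & HM).
  { apply Rplus_le_le_0_compat; [apply Rdiv_le_0_compat; nra|lra]. }
  rewrite <- S_INR in HM.
  assert (He : 0 <= 60 * W * W / eta) by (apply Rdiv_le_0_compat; nra).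
  assert (HM0 : 0 < INR (S M)) by lra.
  set (De := W / INR (S M)).
  assert (HDeM : INR (S M) * De = W) by (unfold De; field; lra).
  assert (HDe : 0 < De <= 1).
  { split; [apply Rdiv_lt_0_compat; lra|].
    apply Rle_div_l; lra. }
  assert (Hsmall : 60 * W * De <= eta).
  { assert (60 * W * W / eta * eta = 60 * W * W) by (field; lra).
    assert (60 * W * W <= eta * INR (S M)) by nra.
    replace (60 * W * De) with (60 * W * W / INR (S M)) by (unfold De; field; lra).
    apply Rle_div_l; lra. }
  destruct (nfloor_ex (2 / De)) as (m & _ & Hm).
  { apply Rdiv_le_0_compat; lra. }
  rewrite <- S_INR in Hm.
  assert (Hm' : 2 <= INR (S m) * De).
  { assert (2 / De * De = 2) by (field; lra). nra. }
  assert (HcW : 0 < cos W) by (apply cos_gt_0; lra).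
  (* Only lengths up to [De] remain, as [zigzag_piece] requires [s * / cos W <= De]. *)
  apply (displacement_cost_subdivide L _ De); [lra|lra|].
  intros x y th th' be len delta Hlen Hd.
  destruct (Req_dec len 0) as [->|Hne].
  { destruct (slide L x y th th' delta) as (l & Hw & Hl); [lra..|].
    exists l; rewrite !Rmult_0_l, !Rmult_0_r, !Rplus_0_r; split; [lra|exact Hl]. }
  (* Chosen so that the tangent at [al + W] has direction [be]. *)
  set (al := be - PI / 2 - W).
  destruct (slide L x y th al (delta / 3)) as (l1' & Hw1 & Hl1); [lra..|].
  destruct (slide L (x + len * cos be) (y + len * sin be) al th' (delta / 3))
    as (l3 & Hw3 & Hl3); [lra..|].
  destruct (zigzag_piece L K W De al m HK HDe ltac:(lra) Hm' (S M) ltac:(lra)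
    (len * cos W) x y (delta / 3)) as (l2 & Hw2 & Hl2).
  { nra. }
  { replace (len * cos W * / cos W) with len by (field; lra); lra. }
  { lra. }
  rewrite HDeM in Hw2, Hl2.
  replace (zig_x al W (len * cos W)) with (len * cos be) in Hl2.
  2:{ rewrite zig_x_polar by lra.
      replace (al + W) with (- (PI / 2 - be)) by (unfold al; ring).
      rewrite sin_neg, sin_shift; field; lra. }
  replace (zig_y al W (len * cos W)) with (len * sin be) in Hl2.
  2:{ rewrite zig_y_polar by lra.
      replace (al + W) with (- (PI / 2 - be)) by (unfold al; ring).
      rewrite cos_neg, cos_shift; field; lra. }
  exists (l1' ++ l2 ++ l3); split.
  - rewrite !weight_app.
    replace (len * cos W * _) with (len * (60 * (INR (S M) * De) * De + sin W * K))
      in Hw2 by (unfold tan; field; lra).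
    rewrite HDeM in Hw2.
    assert (len * (60 * W * De) <= len * eta) by (apply Rmult_le_compat_l; lra).
    nra.
  - eapply reach_trans; [|eapply reach_trans].
    + eapply reach_weaken; [|exact Hl1].
      intros a b d; apply arc_covered_incl, incl_appl, incl_refl.
    + eapply reach_weaken; [|exact Hl2].
      intros a b d [Ha|(-> & _ & _ & Ha)] phi Hphi;
        (apply (covered_incl l2); [apply incl_appr, incl_appl, incl_refl|]).
      * apply Ha; exact Hphi.
      * apply Ha; lra.
    + eapply reach_weaken; [|exact Hl3].
      intros a b d; apply arc_covered_incl, incl_appr, incl_appr, incl_refl.
Qed.

(** Each zigzag round with [eta] equal to [r - sin W] times the current constant multiplies that
    constant by [r < 1]. *)
Lemma displacement_cost_pos L W k : 0 <= L < W -> W < PI / 2 -> 0 < k ->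
  forall l0, displacement_cost L k l0.
Proof.
  intros HL HW Hk.
  set (r := (1 + sin W) / 2).
  assert (HsW : 0 < sin W < 1).
  { split; [apply sin_gt_0; lra|].
    rewrite <- sin_PI2; apply sin_increasing_1; lra. }
  assert (Hr : sin W < r < 1) by (unfold r; lra).
  assert (Hpow : forall n l0, displacement_cost L (4 * (L + 1) * r ^ n) l0).
  { induction n as [|n IH]; intros l0.
    - rewrite pow_O, Rmult_1_r.
      apply (displacement_cost_subdivide L _ 1); [lra|lra|].
      apply displacement_cost_translation; lra.
    - assert (Hp : 0 < 4 * (L + 1) * r ^ n)
        by (apply Rmult_lt_0_compat; [lra|apply pow_lt; lra]).
      replace (4 * (L + 1) * r ^ S n) with (sin W * (4 * (L + 1) * r ^ n)
        + (r - sin W) * (4 * (L + 1) * r ^ n)) by (simpl; ring).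
      apply displacement_cost_zigzag; auto.
      apply Rmult_lt_0_compat; lra. }
  destruct (pow_lt_1_zero r) with (y := k / (4 * (L + 1))) as (n & Hn).
  { rewrite Rabs_right; lra. }
  { apply Rdiv_lt_0_compat; lra. }
  specialize (Hn n (le_n n)).
  apply Rabs_def2 in Hn; destruct Hn as [Hn _].
  intros l0 x y th th' be len delta Hlen Hd.
  destruct (Hpow n l0 x y th th' be len delta Hlen Hd) as (l & Hw & Hl).
  exists l; split; [|exact Hl].
  assert (4 * (L + 1) * r ^ n <= k).
  { assert (k / (4 * (L + 1)) * (4 * (L + 1)) = k) by (field; lra). nra. }
  nra.
Qed.

(** The centre moves parallel to one axis, then the other, each at a cost per unit length small
    against the distance; a negative distance is a positive one in the opposite direction. *)
Lemma reach_small_cover L W x y th x' y' th' eps :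
  0 <= L < W -> W < PI / 2 -> 0 < eps ->
  exists l, weight l <= eps /\ reach (arc_covered L l) x y th x' y' th'.
Proof.
  intros HL HW Heps.
  assert (Haxis : forall x y th th' be d eps, 0 < eps ->
    exists l, weight l <= eps /\
      reach (arc_covered L l) x y th (x + d * cos be) (y + d * sin be) th').
  { clear x y th x' y' th' eps Heps; intros x y th th' be d eps Heps.
    assert (Hk : 0 < eps / 2 / (Rabs d + 1)).
    { pose proof (Rabs_pos d); repeat apply Rdiv_lt_0_compat; lra. }
    assert (Hkd : eps / 2 / (Rabs d + 1) * Rabs d + eps / 2 <= eps).
    { pose proof (Rabs_pos d).
      assert (eps / 2 / (Rabs d + 1) * (Rabs d + 1) = eps / 2) by (field; lra).
      lra. }
    set (be' := if Rle_dec 0 d then be else be + PI).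
    destruct (displacement_cost_pos L W _ HL HW Hk (Rabs d) x y th th' be'
      (Rabs d) (eps / 2)) as (l & Hw & Hl).
    { pose proof (Rabs_pos d); lra. } { lra. }
    exists l; split; [lra|].
    unfold be' in Hl; destruct (Rle_dec 0 d).
    - rewrite Rabs_right in Hl by lra; exact Hl.
    - rewrite Rabs_left, neg_cos, neg_sin, !Rmult_opp_opp in Hl by lra; exact Hl. }
  destruct (Haxis x y th th 0 (x' - x) (eps / 2)) as (l1 & Hw1 & Hl1); [lra|].
  destruct (Haxis x' y th th' (PI / 2) (y' - y) (eps / 2)) as (l2 & Hw2 & Hl2);
    [lra|].
  rewrite cos_0, sin_0, Rmult_1_r, Rmult_0_r, Rplus_0_r in Hl1.
  rewrite cos_PI2, sin_PI2, Rmult_1_r, Rmult_0_r, Rplus_0_r in Hl2.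
  replace (x + (x' - x)) with x' in Hl1 by ring.
  replace (y + (y' - y)) with y' in Hl2 by ring.
  exists (l1 ++ l2); split; [rewrite weight_app; lra|].
  eapply reach_trans.
  - eapply reach_weaken; [|exact Hl1].
    intros a b d; apply arc_covered_incl, incl_appl, incl_refl.
  - eapply reach_weaken; [|exact Hl2].
    intros a b d; apply arc_covered_incl, incl_appr, incl_refl.
Qed.

(** * Motions and outer measure *)

Lemma continuity_cont01 f : continuity f -> cont01 f.
Proof.
  intros H t _ eps Heps.
  destruct (H t eps Heps) as (d & Hd & Hc).
  exists d; split; [exact Hd|]; intros u _ Hu.
  destruct (Req_dec u t) as [->|Hne].
  - rewrite Rminus_diag, Rabs_R0; exact Heps.
  - apply (Hc u); split; [split; [exact I|auto]|exact Hu].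
Qed.

(** [Rabs r] keeps the rectangle ordered even for a negative entry, and its area is still
    [4 * r ^ 2]. *)
Definition square_rect (c : R * R * R) : R * R * R * R :=
  let '(a, b, r) := c in (a - Rabs r, a + Rabs r, b - Rabs r, b + Rabs r).

Lemma covered_measure_lt (E : pt -> Prop) l eps :
  (forall q, E q -> covered l (fst q) (snd q)) -> 4 * weight l < eps ->
  measure_lt E eps.
Proof.
  intros HE Hw.
  (* The default [(0, 0, 0)] pads the finite list with degenerate squares of area 0. *)
  exists (fun n => square_rect (nth n l (0, 0, 0))), (4 * weight l).
  split; [|split; [|split]].
  - intros n; destruct (nth n l (0, 0, 0)) as [[a b] r]; simpl.
    pose proof (Rabs_pos r); lra.
  - intros q Hq; destruct (HE q Hq) as (a & b & r & Hin & Hx & Hy).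
    destruct (In_nth l (a, b, r) (0, 0, 0) Hin) as (n & _ & Hn).
    exists n; rewrite Hn; simpl.
    pose proof (Rle_abs r).
    apply Rabs_le_between in Hx, Hy; lra.
  - intros N; clear HE Hw.
    assert (Hw0 : forall l, 0 <= weight l).
    { induction l0 as [|[c r] l0 IH]; simpl; [lra|nra]. }
    assert (Hz : forall N, sum_f_R0 (fun n => rect_area (square_rect
      (nth n [] (0, 0, 0)))) N = 0).
    { induction N0 as [|N0 IH]; simpl in *; rewrite ?IH;
        [|destruct N0]; simpl; rewrite Rabs_R0; ring. }
    revert N; induction l as [|[[a b] r] l IH]; intros N.
    + rewrite Hz; simpl; lra.
    + assert (Hr : rect_area (square_rect (a, b, r)) = 4 * r ^ 2).
      { rewrite <- (pow2_abs r); simpl; ring. }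
      destruct N as [|N].
      * cbn [sum_f_R0 nth]; rewrite Hr; cbn [weight]; pose proof (Hw0 l); lra.
      * rewrite decomp_sum by lia; cbn [pred nth]; rewrite Hr; cbn [weight].
        pose proof (IH N); lra.
  - exact Hw.
Qed.

Theorem theorem2 :
  forall (x0 y0 alpha L : R), 0 < L < 132 / 100 ->
  forall (e : pt),
    (e = (x0 + cos alpha, y0 + sin alpha) \/
     e = (x0 + cos (alpha + L), y0 + sin (alpha + L))) ->
  forall (beta : R) (eps : R), 0 < eps ->
  exists g : motion,
    (forall p, gmap g 0 p = p) /\
    (forall q, image (gmap g 1) (arc x0 y0 alpha L) q <->
               image (rot_about e beta) (arc x0 y0 alpha L) q) /\
    measure_lt (swept g (arc x0 y0 alpha L)) eps.
Proof.
  intros x0 y0 alpha L HL e _ beta eps Heps.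
  assert (HW : 132 / 100 < PI / 2) by (pose proof PI2_3_2; lra).
  (* The rotation carries the centre to its image and adds [beta] to every angle. Weight [eps / 8]
     means area at most [eps / 2]. *)
  destruct (reach_small_cover L (132 / 100) x0 y0 alpha
    (fst (rot_about e beta (x0, y0))) (snd (rot_about e beta (x0, y0)))
    (alpha + beta) (eps / 8)) as (l & Hw & Hl); [lra..|].
  destruct Hl as (X & Y & T & (CX & CY & CT) & (X0 & Y0 & T0) & (X1 & Y1 & T1) & HE).
  assert (Cc : continuity (fun t => cos (T t - alpha))).
  { apply (continuity_comp (fun t => T t - alpha) cos); [|exact continuity_cos].
    apply (continuity_minus T (fun _ => alpha)); [exact CT|].
    apply continuity_const; intros u v; reflexivity. }
  assert (Cs : continuity (fun t => sin (T t - alpha))).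
  { apply (continuity_comp (fun t => T t - alpha) sin); [|exact continuity_sin].
    apply (continuity_minus T (fun _ => alpha)); [exact CT|].
    apply continuity_const; intros u v; reflexivity. }
  assert (Ck : forall k f, continuity f -> continuity (fun t => f t * k)).
  { intros k f Hf; apply (continuity_mult f (fun _ => k)); [exact Hf|].
    apply continuity_const; intros u v; reflexivity. }
  (* The isometry that rotates by [T t - alpha] and takes the original centre to [(X t, Y t)]. *)
  unshelve epose (g := {|
    m_c := fun t => cos (T t - alpha);
    m_s := fun t => sin (T t - alpha);
    m_a := fun t => X t - (cos (T t - alpha) * x0 - sin (T t - alpha) * y0);
    m_b := fun t => Y t - (sin (T t - alpha) * x0 + cos (T t - alpha) * y0) |}).
  { intros t _; cbn beta.
    pose proof (sin2_cos2 (T t - alpha)) as H; unfold Rsqr in H; lra. }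
  { repeat split; apply continuity_cont01; auto.
    - apply (continuity_minus X); [exact CX|].
      apply (continuity_minus (fun t => cos (T t - alpha) * x0)
        (fun t => sin (T t - alpha) * y0)); auto.
    - apply (continuity_minus Y); [exact CY|].
      apply (continuity_plus (fun t => sin (T t - alpha) * x0)
        (fun t => cos (T t - alpha) * y0)); auto. }
  exists g.
  split; [|split].
  - intros [px py]; unfold gmap, iso_apply; simpl.
    rewrite X0, Y0, T0, Rminus_diag, cos_0, sin_0; f_equal; ring.
  (* The final isometry equals the rotation on the whole plane, so the two images coincide. *)
  - enough (Hg : forall p, gmap g 1 p = rot_about e beta p).
    { intros q; split; intros (p & Hp & Hq); exists p; split; auto;
        [rewrite <- Hg|rewrite Hg]; exact Hq. }
    intros [px py]; unfold gmap, iso_apply; simpl.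
    rewrite X1, Y1, T1; replace (alpha + beta - alpha) with beta by ring.
    unfold rot_about; simpl; f_equal; ring.
  - apply (covered_measure_lt _ l); [|lra].
    intros q (t & Ht & p & (phi & Hphi & ->) & <-).
    unfold gmap, iso_apply; simpl.
    pose proof (HE t Ht (phi + (T t - alpha)) ltac:(lra)) as H.
    rewrite cos_plus, sin_plus in H.
    replace (_ + (X t - _)) with (X t + (cos phi * cos (T t - alpha)
      - sin phi * sin (T t - alpha))) by ring.
    replace (_ + (Y t - _)) with (Y t + (sin phi * cos (T t - alpha)
      + cos phi * sin (T t - alpha))) by ring.
    exact H.
Qed.
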